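(* Let $f:\mathbb{R}_+\to\mathbb{R}_+$ be Lebesgue measurable. Suppose that $$a_q f(q\lambda)\to g(\lambda)\qquad (q\to\infty\text{ through }\mathbb{Q}_+)\qquad\text{for each }\lambda\in B,$$ for some non-null measurable set $B\subseteq(0,\infty)$, some positive family $\{a_q\}_{q\in\mathbb{Q}_+}$ and some function $g:B\to\mathbb{R}_+$. Then $f$ is weakly almost regularly varying: for each $s>0$, $$K(s):=\mathrm{ess}\text{-}\lim_{\lambda\to\infty}f(s\lambda)/f(\lambda)$$ exists and is finite, and $K$ is multiplicative, i.e. $K(st)=K(s)K(t)$ for all $s,t>0$. Moreover $K$ is locally bounded near $s=1$, and so for some $\kappa\in\mathbb{R}$, $K(s)=s^{\kappa}$ for all $s>0$.
   Context: $\mathbb{R}_+:=(0,\infty)$; $\mathbb{Q}_+$ is the set of positive rationals. Essential limit (measure version): for a real-valued function $f$ and a real number $L$, $\mathrm{ess}\text{-}\lim_{x\to\infty}f(x)=L$ means that for each $\varepsilon>0$ there are $X_\varepsilon\in\mathbb{R}$ and a Lebesgue-null set $M_\varepsilon$ such that $|f(x)-L|<\varepsilon$ for all $x>X_\varepsilon$ with $x\notin M_\varepsilon$. A measurable function $f:\mathbb{R}_+\to\mathbb{R}_+$ is weakly almost regularly varying if $\mathrm{ess}\text{-}\lim_{x\to\infty}f(tx)/f(x)$ (measure version) exists and is finite for each $t>0$. *)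

(* Defs.v *)
From mathcomp Require Import all_boot all_order all_algebra.
From mathcomp Require Import all_classical all_reals all_analysis.

Set Implicit Arguments.
Unset Strict Implicit.
Unset Printing Implicit Defensive.

Import Order.TTheory GRing.Theory Num.Theory.
Import numFieldNormedType.Exports.

Local Open Scope classical_set_scope.
Local Open Scope ring_scope.

(* The real line with the sigma-algebra of all Lebesgue measurable sets (not
   only the Borel ones); [completed_lebesgue_measure] is a complete measure on
   it. *)
Definition lebesgueType (R : realType) : measurableType _ :=
  caratheodory_type (wlength (idfun : R -> R))^*%mu.

Definition lebesgue_measurable (R : realType) (A : set R) : Prop :=
  measurable (A : set (lebesgueType R)).

Definition lebesgue_measurable_fun (R : realType) (D : set R) (f : R -> R) :
    Prop :=
  measurable_fun (D : set (lebesgueType R))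
    (f : lebesgueType R -> measurableTypeR R).

Definition lebesgue_null (R : realType) (A : set R) : Prop :=
  completed_lebesgue_measure.-negligible (A : set (lebesgueType R)).

(* A function on (0, oo) is represented by a total function on R whose values
   on ]-oo, 0] are irrelevant; below, X may always be taken nonnegative. *)
Definition is_ess_lim (R : realType) (h : R -> R) (L : R) : Prop :=
  forall e : R, 0 < e ->
    exists (X : R) (M : set R), lebesgue_null M /\
      forall x : R, X < x -> ~ M x -> `|h x - L| < e.

Definition weakly_almost_regularly_varying (R : realType) (f : R -> R) : Prop :=
  [/\ forall x : R, 0 < x -> 0 < f x,
      lebesgue_measurable_fun `]0, +oo[ f
    & forall t : R, 0 < t ->
        exists L : R, is_ess_lim (fun x => f (t * x) / f x) L].

(* Main.v *)
Require Import Defs.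
From mathcomp Require Import all_boot all_order all_algebra.
From mathcomp Require Import all_classical all_reals all_analysis.
From mathcomp Require Import measurable_realfun ring lra.

Import Order.TTheory GRing.Theory Num.Theory.
Import numFieldNormedType.Exports.

Local Open Scope classical_set_scope.
Local Open Scope ring_scope.

(* Fix s with D := B `&` s^-1 B non-null (by Steinhaus, every s near 1). On D
   the ratios f(s q l) / f(q l) converge as q -> oo through the rationals, so
   for each e they are within e of a single constant for all l in some non-null
   measurable E `<=` D and all rational q beyond some n. Since the rational
   dilates of E fill (0, oo) up to a null set, almost every large x has the form
   q l with such q and l: hence f(s x) / f(x) is essentially Cauchy, and no
   uniform convergence theorem is needed. The same device, applied to a piece of
   B on which a_q f(q l) stays in [1/n, n], bounds K by n^2 near 1. The set of s
   where K exists is closed under products and contains a neighbourhood of 1, so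
   it is (0, oo); a multiplicative K bounded near 1 is a power. *)

Set Implicit Arguments.
Unset Strict Implicit.
Unset Printing Implicit Defensive.

(** * Lebesgue measurable and null sets under dilation *)

(** This moves null sets to the Borel measure, where the density and scaling results apply: a set of
    outer measure zero has a Borel null cover. *)
Lemma lebesgue_nullE (R : realType) (N : set R) :
  lebesgue_null N <-> (@lebesgue_measure R).-negligible N.
Proof.
split=> [[A [_ A0 NA]]|[A [mA A0 NA]]]; last first.
  by exists A; split => //; exact: sub_caratheodory.
apply/negligible_outer_measure/eqP; rewrite eq_le outer_measure_ge0 andbT.
by rewrite -[leRHS]A0 le_outer_measure.
Qed.

Lemma lebesgue_nullS (R : realType) (A B : set R) :
  A `<=` B -> lebesgue_null B -> lebesgue_null A.
Proof. by move=> AB; rewrite /lebesgue_null; exact: negligibleS. Qed.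

Lemma lebesgue_nullU (R : realType) (A B : set R) :
  lebesgue_null A -> lebesgue_null B -> lebesgue_null (A `|` B).
Proof. by rewrite /lebesgue_null; exact: negligibleU. Qed.

Lemma lebesgue_null_bigcup (R : realType) (I : countType) (F : I -> set R) :
  (forall i, lebesgue_null (F i)) -> lebesgue_null (\bigcup_i F i).
Proof.
move=> F0.
pose G k : set R := if (unpickle k : option I) is Some i then F i else set0.
apply: (@lebesgue_nullS _ _ (\bigcup_k G k)).
  by move=> x [i _ Fx]; exists (pickle i) => //; rewrite /G pickleK.
apply: negligible_bigcup => k; rewrite /G; case: unpickle => [i|]; first exact: F0.
exact: negligible_set0.
Qed.

(** The Caratheodory sigma-algebra is the completion of the Borel one, so a measurable set is the
    union of a Borel set and a null set. *)
Lemma lebesgue_measurable_inner_borel (R : realType) (A : set R) :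
  lebesgue_measurable A ->
  exists X : set (measurableTypeR R),
    [/\ measurable X, X `<=` A & lebesgue_null (A `\` X)].
Proof.
rewrite /lebesgue_measurable -completed_caratheodory_measurable.
rewrite g_sigma_completed_algebra_genE => -[X mX [N nN <-]].
exists X; split; [exact: mX|exact: subsetUl|].
apply/lebesgue_nullE; apply: negligibleS nN.
by move=> x [[]].
Qed.

Lemma lebesgue_nonnull_inner_borel (R : realType) (A : set R) :
  lebesgue_measurable A -> ~ lebesgue_null A ->
  exists X : set (measurableTypeR R),
    [/\ measurable X, X `<=` A & ~ lebesgue_null X].
Proof.
move=> /lebesgue_measurable_inner_borel[X [mX XA nX]] nA.
exists X; split => // X0; apply: nA.
apply: (@lebesgue_nullS _ _ (X `|` A `\` X)); last exact: lebesgue_nullU.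
by move=> x Ax; have [Xx|nXx] := pselect (X x); [left|right].
Qed.

(** Uniqueness of Lebesgue measure: the rescaled pushforward [m] gives each half-open interval its
    length. *)
Lemma lebesgue_measureZ (R : realType) (y : R) (A : set (measurableTypeR R)) :
  0 < y -> measurable A ->
  lebesgue_measure A = (y%:E * lebesgue_measure ( *%R y @^-1` A))%E.
Proof.
move=> y0 mA.
have my : measurable_fun setT ( *%R y : measurableTypeR R -> measurableTypeR R).
  exact: mulrl_measurable.
pose m := mscale (NngNum (ltW y0))
  (measure_function_pushforward__canonical__measure_function_Measure
     lebesgue_measure my).
have mE X : m X = (y%:E * lebesgue_measure ( *%R y @^-1` X))%E by [].
rewrite -mE; apply: lebesgue_measure_unique mA => _ /ocitvP[->|[[u v] /= uv ->]].
  by rewrite !measure0.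
apply: (etrans _ (esym (mE _))).
rewrite (_ : *%R y @^-1` _ = `](u / y), (v / y)]%classic); last first.
  apply/seteqP; split => x /=; rewrite !in_itv/=;
    by rewrite ltr_pdivrMr// ler_pdivlMr// mulrC.
rewrite !lebesgue_measure_itv/= !lte_fin ltr_pM2r ?invr_gt0// uv -!EFinB -EFinM.
by congr EFin; rewrite -mulrBl mulrC divfK// gt_eqF.
Qed.

Lemma lebesgue_null_preimageZ (R : realType) (y : R) (N : set R) :
  0 < y -> lebesgue_null N -> lebesgue_null ( *%R y @^-1` N).
Proof.
move=> y0 /lebesgue_nullE[A [mA A0 NA]]; apply/lebesgue_nullE.
have my : measurable_fun setT ( *%R y : measurableTypeR R -> measurableTypeR R).
  exact: mulrl_measurable.
exists ( *%R y @^-1` A); split.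
- by rewrite -[X in measurable X]setTI; exact: my.
- have := lebesgue_measureZ y0 mA; rewrite A0 => /esym/eqP.
  by rewrite mule_eq0 eqe gt_eqF//= => /eqP.
- by move=> x; exact: NA.
Qed.

Lemma lebesgue_measurable_preimageZ (R : realType) (y : R) (A : set R) :
  0 < y -> lebesgue_measurable A -> lebesgue_measurable ( *%R y @^-1` A).
Proof.
move=> y0 /lebesgue_measurable_inner_borel[X [mX XA nX]].
rewrite (_ : *%R y @^-1` A = *%R y @^-1` X `|` *%R y @^-1` (A `\` X)).
  apply: measurableU; last first.
    apply: completed_lebesgue_measure_is_complete.
    exact: lebesgue_null_preimageZ.
  apply: sub_caratheodory; rewrite -[X in measurable X]setTI.
  exact: (mulrl_measurable _).
by rewrite -preimage_setU setDUK.
Qed.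

(** * Density points and dilates *)

(* 3/4 of the measure 2 r of the ball; any proportion above 1/2 would do. *)
Definition dense_at (R : realType) (X : set R) (x : R) :=
  \forall r \near 0^'+,
    ((3 / 2 * r)%:E <= (@lebesgue_measure R) (X `&` ball x r))%E.

(** By the Lebesgue density theorem almost every point of [X] has density 1, hence proportion above
    3/4 in all small balls. *)
Lemma exists_dense_at (R : realType) (X : set (measurableTypeR R)) :
  measurable X -> ~ lebesgue_null X -> exists2 x, X x & dense_at X x.
Proof.
move=> mX nX; apply: contra_notP nX => noX; apply/lebesgue_nullE.
apply: negligibleS (lebesgue_density mX) => x Xx /= cvg_x; apply: noX.
exists x => //; move: cvg_x; rewrite indicE mem_set//= => cvg_x.
have : \forall r \near 0^'+,
    ((3 / 4)%:E < (@lebesgue_measure R) (X `&` ball x r) *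
     (lebesgue_measure (ball x r))^-1)%E.
  apply: (cvg_x [set y | ((3 / 4)%:E < y)%E]).
  apply: open_nbhs_nbhs; split; first exact: open_ereal_gt_ereal.
  by rewrite /= lte_fin; lra.
move=> cvg34; near=> r.
have r0 : 0 < r by near: r; exact: nbhs_right_gt.
have : ((3 / 4)%:E < (@lebesgue_measure R) (X `&` ball x r) *
     (lebesgue_measure (ball x r))^-1)%E.
  by near: r.
rewrite (lebesgue_measure_ball _ (ltW r0)) inver mulrn_eq0/= gt_eqF//.
rewrite lte_pdivlMr ?mulrn_wgt0// => /ltW; rewrite -EFinM.
by rewrite (_ : 3 / 4 * (r *+ 2) = 3 / 2 * r)//; lra.
Unshelve. all: by end_near. Qed.

(** A two-set Steinhaus argument: for [y] near [e / d], division by [y] carries the part of [Y]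
    around [e] to a set around a point close to [d], where [X] is dense too. *)
Lemma nonnull_dilate_meet (R : realType) (X Y : set (measurableTypeR R)) (d e : R) :
  measurable X -> measurable Y -> 0 < d -> 0 < e ->
  dense_at X d -> dense_at Y e ->
  \forall y \near e / d, ~ lebesgue_null (X `&` *%R y @^-1` Y).
Proof.
move=> mX mY d0 e0 Xd Ye.
move: Xd Ye => [rX/= rX0 HX] [rY/= rY0 HY].
have c0 : 0 < e / d by rewrite divr_gt0.
have cd : e / d * d = e by rewrite divfK// gt_eqF.
move: (e / d) c0 cd => c c0 cd.
(* The ball around [d] has radius [r], below [rX]; the one around [e] has radius [y * r], below [rY]
   as soon as [y < 2 * c]. *)
pose r := Num.min rX (rY / (2 * c)) / 2.
have m0 : 0 < Num.min rX (rY / (2 * c)).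
  by rewrite lt_min rX0 divr_gt0// mulr_gt0.
have r0 : 0 < r by rewrite divr_gt0.
have rltX : r < rX.
  have : Num.min rX (rY / (2 * c)) <= rX by rewrite ge_min lexx.
  by move: m0; rewrite /r; lra.
have rltY : 2 * c * r < rY.
  have : Num.min rX (rY / (2 * c)) <= rY / (2 * c) by rewrite ge_min lexx orbT.
  rewrite ler_pdivlMr ?mulr_gt0// /r => h.
  have : 0 < Num.min rX (rY / (2 * c)) * (2 * c) by rewrite !mulr_gt0.
  move: h; set mm := Num.min _ _; lra.
have Xr : ((3 / 2 * r)%:E <= (@lebesgue_measure R) (X `&` ball d r))%E.
  by apply: HX => //; rewrite /ball/= sub0r normrN gtr0_norm.
(* The first bound keeps [y] between [c / 2] and [2 * c]. The second puts the centre [e / y] within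
   [r / 4] of [d], whence the radius [5 / 4 * r] below. *)
pose eta := Num.min (c / 2) (r * c / (8 * d)).
have eta0 : 0 < eta by rewrite lt_min !divr_gt0 ?mulr_gt0.
exists eta => //= y; rewrite /ball/= => cy.
have cy1 : `|c - y| < c / 2 by rewrite (lt_le_trans cy)// ge_min lexx.
have cy2 : `|c - y| * (8 * d) < r * c.
  by rewrite -ltr_pdivlMr ?mulr_gt0// (lt_le_trans cy)// ge_min lexx orbT.
have y2 : c / 2 < y by move: cy1; rewrite ltr_norml => /andP[]; lra.
have y3 : y < 2 * c by move: cy1; rewrite ltr_norml => /andP[]; lra.
have y0 : 0 < y by move: y2 c0; lra.
have Yr : ((3 / 2 * (y * r))%:E <= (@lebesgue_measure R) (Y `&` ball e (y * r)))%E.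
  apply: HY; rewrite ?mulr_gt0//= /ball/= sub0r normrN gtr0_norm ?mulr_gt0//.
  by rewrite (lt_trans _ rltY)// ltr_pM2r.
have mXr : measurable (X `&` ball d r).
  by apply: measurableI => //; exact: measurable_ball.
have mYr : measurable (Y `&` ball e (y * r)).
  by apply: measurableI => //; exact: measurable_ball.
have mZ : measurable ( *%R y @^-1` (Y `&` ball e (y * r))).
  rewrite -[X in measurable X]setTI; exact: (mulrl_measurable _).
have Zr : ((3 / 2 * r)%:E <=
    (@lebesgue_measure R) ( *%R y @^-1` (Y `&` ball e (y * r))))%E.
  move: Yr; rewrite (lebesgue_measureZ y0 mYr) mulrCA EFinM.
  by rewrite lee_pmul2l// lte_fin.
(* Both pieces have measure at least 3/2 r and lie in a common ball of measure
   5/2 r, so they cannot be disjoint up to a null set. *)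
have ZB : *%R y @^-1` (Y `&` ball e (y * r)) `<=` ball d (5 / 4 * r).
  move=> x [_]; rewrite /ball/= => ex.
  have : y * `|d - x| < y * (5 / 4 * r).
    have -> : y * `|d - x| = `|(e - y * x) - (c - y) * d|.
      rewrite -{1}(gtr0_norm y0) -normrM; congr (`|_|); rewrite -cd; ring.
    rewrite (le_lt_trans (ler_normB _ _))// normrM (gtr0_norm d0).
    move: ex cy2 y2; set u := `|e - _|; set v := `|c - y| => h1 h2 h3.
    have : r * (c / 2) < r * y by rewrite ltr_pM2l.
    lra.
  by rewrite ltr_pM2l.
have XB : X `&` ball d r `<=` ball d (5 / 4 * r).
  by move=> x [_]; rewrite /ball/= => /lt_trans; apply; lra.
rewrite lebesgue_nullE => nXY.
have nXZ : lebesgue_measure ((X `&` ball d r) `&`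
    *%R y @^-1` (Y `&` ball e (y * r))) = 0%E :> \bar R.
  apply/negligibleP; first exact: measurableI.
  by apply: negligibleS nXY => x [[? _] [? _]].
have Zfin : ((@lebesgue_measure R) ( *%R y @^-1` (Y `&` ball e (y * r))) < +oo)%E.
  apply: (@le_lt_trans _ _ (lebesgue_measure (ball d (5 / 4 * r)))).
    by apply: le_measure => //; rewrite inE//; exact: measurable_ball.
  by rewrite lebesgue_measure_ball ?ltry// mulr_ge0// ltW.
have : ((@lebesgue_measure R)
    (X `&` ball d r `|` *%R y @^-1` (Y `&` ball e (y * r))) <=
    (5 / 4 * r *+ 2)%:E)%E.
  rewrite -(lebesgue_measure_ball d); last by rewrite mulr_ge0// ltW.
  apply: le_measure; last by rewrite subUset.
    by rewrite inE; exact: measurableU.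
  by rewrite inE; exact: measurable_ball.
rewrite measureUfinr// [X in (_ - X)%E]nXZ sube0; apply/negP; rewrite -ltNge.
apply: lt_le_trans (leeD Xr Zr).
by rewrite -EFinD lte_fin; lra.
Qed.

Lemma ratr_dense_nbhs (R : realType) (c : R) (P : set R) :
  (\forall y \near c, P y) -> exists q : rat, P (ratr q).
Proof.
move=> [e /= e0 H].
have /rat_in_itvoo[q] : c - e < c + e by rewrite ltrD2l gtrN.
rewrite in_itv/= => /andP[h1 h2]; exists q; apply: H; rewrite /ball/=.
by rewrite ltr_norml; apply/andP; split; lra.
Qed.

Lemma lebesgue_measurable_forall_rat (R : realType) (F : rat -> set R) :
  (forall q, lebesgue_measurable (F q)) ->
  lebesgue_measurable [set x | forall q, F q x].
Proof.
move=> mF; rewrite (_ : [set _ | _] = ~` (\bigcup_q ~` F q)).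
  apply: measurableC; apply: bigcupT_measurable_rat => q.
  exact: measurableC (mF q).
rewrite setC_bigcup; apply/seteqP; split => x h q => [_|].
  by rewrite setCK; exact: h.
by have := h q I; rewrite setCK.
Qed.

Lemma lebesgue_measurable_itv (R : realType) (i : interval R) :
  lebesgue_measurable [set` i].
Proof. by apply: sub_caratheodory; exact: measurable_itv. Qed.

(** Were the uncovered set [N] non-null, density points [d] of [E] and [e] of [N] would give a
    rational [q] near [e / d] and a point [x] of [E] with [q x] in [N], although [q x / q] lies in
    [E]. *)
Lemma lebesgue_null_rat_dilates_compl (R : realType) (E : set R) :
  E `<=` `]0, +oo[ -> lebesgue_measurable E -> ~ lebesgue_null E ->
  lebesgue_null [set x | 0 < x /\ forall q : rat, 0 < q -> ~ E (x / ratr q)].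
Proof.
move=> Epos mE nE; set N := [set x | _].
have mN : lebesgue_measurable N.
  have -> : N = `]0, +oo[ `&`
      [set x | forall q : rat, 0 < q -> ~ E (x / ratr q)].
    by apply/seteqP; split => x; rewrite /= in_itv/= andbT.
  apply: measurableI; first exact: lebesgue_measurable_itv.
  apply: (@lebesgue_measurable_forall_rat _
    (fun q => [set x | 0 < q -> ~ E (x / ratr q)])) => q.
  have [q0|q0] := ltP 0 q; last first.
    rewrite (_ : [set _ | _] = setT); last first.
      by apply/seteqP; split => // x _; rewrite /= ltNge q0.
    by rewrite /lebesgue_measurable; exact: measurableT.
  rewrite (_ : [set _ | _] = ~` ( *%R (ratr q)^-1 @^-1` E)); last first.
    apply/seteqP; split => x; rewrite /= mulrC; first exact.
    by move=> h _.
  apply: measurableC; apply: lebesgue_measurable_preimageZ mE.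
  by rewrite invr_gt0 ltr0q.
apply: contrapT => nN.
have [X [mX XE nX]] := lebesgue_nonnull_inner_borel mE nE.
have [Y [mY YN nY]] := lebesgue_nonnull_inner_borel mN nN.
have [d Xd dX] := exists_dense_at mX nX.
have [e Ye eY] := exists_dense_at mY nY.
have d0 : 0 < d by have := Epos _ (XE _ Xd); rewrite /= in_itv/= andbT.
have e0 : 0 < e by have [] := YN _ Ye.
have pos : \forall y \near e / d, 0 < y by apply: lt_nbhsr; rewrite divr_gt0.
have [q [q0 nq]] := ratr_dense_nbhs
  (filterI pos (nonnull_dilate_meet mX mY d0 e0 dX eY)).
apply: nq; rewrite (_ : _ `&` _ = set0); first exact: negligible_set0.
apply/seteqP; split => // x [Xx Yx].
have [_ /(_ q)] := YN _ Yx; rewrite -(ltr0q R) => /(_ q0); apply.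
by rewrite mulrC mulKf ?gt_eqF//; exact: XE.
Qed.

(** Both sets are taken equal, with the same density point, so that [e / d] is 1. *)
Lemma steinhaus_dilate (R : realType) (C : set R) :
  C `<=` `]0, +oo[ -> lebesgue_measurable C -> ~ lebesgue_null C ->
  \forall s \near (1 : R), ~ lebesgue_null (C `&` *%R s @^-1` C).
Proof.
move=> Cpos mC nC.
have [X [mX XC nX]] := lebesgue_nonnull_inner_borel mC nC.
have [d Xd dX] := exists_dense_at mX nX.
have d0 : 0 < d by have := Cpos _ (XC _ Xd); rewrite /= in_itv/= andbT.
have := nonnull_dilate_meet mX mX d0 d0 dX dX.
rewrite divff ?gt_eqF//; apply: filterS => s; apply: contra_not.
by apply: lebesgue_nullS => x [/XC Cx /XC].
Qed.

(** * The filter of essential neighbourhoods of +oo *)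

(** As a filter, these neighbourhoods give access to limit algebra and the Cauchy criterion. *)
Definition ess_pinfty (R : realType) : set_system R := fun P =>
  exists (X : R) (M : set R),
    lebesgue_null M /\ forall x, X < x -> ~ M x -> P x.

Lemma lebesgue_nonnull_itvoy (R : realType) (X : R) :
  ~ lebesgue_null (`]X, +oo[ : set R).
Proof.
move=> /lebesgue_nullE/negligibleP -/(_ (measurable_itv _)).
by rewrite /= lebesgue_measure_itv/= ltry.
Qed.

(** Properness holds because a ray is not null; uniqueness of essential limits rests on it. *)
Global Instance ess_pinfty_proper (R : realType) : ProperFilter (@ess_pinfty R).
Proof.
split=> [[X [M [M0 MX]]]|].
  apply: (@lebesgue_nonnull_itvoy _ X); apply: lebesgue_nullS M0 => x.
  by rewrite /= in_itv/= andbT => Xx; apply: contrapT => /(MX _ Xx).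
split.
- by exists 0, set0; split => //; exact: negligible_set0.
- move=> P Q [X [M [M0 MX]]] [Y [N [N0 NY]]].
  exists (Num.max X Y), (M `|` N); split; first exact: lebesgue_nullU.
  move=> x; rewrite gt_max => /andP[Xx Yx] /not_orP[nM nN].
  by split; [exact: MX|exact: NY].
- by move=> P Q PQ [X [M [M0 MX]]]; exists X, M; split => // x *; apply/PQ/MX.
Qed.

Lemma ess_pinfty_gt (R : realType) (X : R) :
  \forall x \near @ess_pinfty R, X < x.
Proof. by exists X, set0; split => //; exact: negligible_set0. Qed.

Lemma is_ess_limP (R : realType) (h : R -> R) (L : R) :
  is_ess_lim h L <-> h x @[x --> @ess_pinfty R] --> L.
Proof.
split=> [hL|/cvgrPdist_lt hL e /hL [X [M [M0 MX]]]].
  apply/cvgrPdist_lt => e /hL[X [M [M0 MX]]]; exists X, M; split => // x *.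
  by rewrite distrC; exact: MX.
by exists X, M; split => // x *; rewrite distrC; exact: MX.
Qed.

Lemma ess_pinftyZ (R : realType) (t : R) : 0 < t ->
  t * x @[x --> @ess_pinfty R] --> @ess_pinfty R.
Proof.
move=> t0 P [X [M [M0 MX]]]; exists (X / t), ( *%R t @^-1` M); split.
  exact: lebesgue_null_preimageZ.
by move=> x; rewrite ltr_pdivrMr// mulrC => Xx nM; exact: MX.
Qed.

(** Almost every [x > 0] is [q l] with [l] in [E]. As [l <= m], taking [x] beyond [n |m|] forces
    [q > n]. *)
Lemma ess_pinfty_rat_dilates (R : realType) (E : set R) (m : R) (n : nat)
    (P : set R) :
  E `<=` `]0, +oo[ -> lebesgue_measurable E -> ~ lebesgue_null E ->
  (forall l, E l -> l <= m) ->
  (forall l (q : rat), E l -> n%:R < q -> P (ratr q * l)) ->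
  \forall x \near @ess_pinfty R, P x.
Proof.
move=> Epos mE nE Em PE.
have := lebesgue_null_rat_dilates_compl Epos mE nE; set N := [set x | _] => N0.
exists (n%:R * `|m|), N; split => // x mx Nx.
have x0 : 0 < x by rewrite (le_lt_trans _ mx)// mulr_ge0.
have [q [q0 Exq]] : exists q : rat, 0 < q /\ E (x / ratr q).
  apply: contrapT => noq; apply: Nx; split => // q q0 Exq.
  by apply: noq; exists q.
have q0' : 0 < ratr q :> R by rewrite ltr0q.
have -> : x = ratr q * (x / ratr q) by rewrite mulrC divfK// gt_eqF.
apply: PE => //; rewrite -(ltr_rat R) ratr_nat.
have xm : x <= ratr q * `|m|.
  by rewrite mulrC -ler_pdivrMr// (le_trans (Em _ Exq))// ler_norm.
have := lt_le_trans mx xm; have [->|m0] := eqVneq m 0.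
  by rewrite normr0 !mulr0 ltxx.
by rewrite ltr_pM2r ?normr_gt0.
Qed.

Lemma lebesgue_nonnull_piece (R : realType) (D : set R) (I : countType)
    (F : I -> set R) :
  ~ lebesgue_null D -> D `<=` \bigcup_i F i -> exists i, ~ lebesgue_null (F i).
Proof.
move=> nD DF; apply: contrapT => noF; apply: nD.
apply: lebesgue_nullS DF _; apply: lebesgue_null_bigcup => i.
by apply: contrapT => nF; apply: noF; exists i.
Qed.

(** * Ratios f(s x) / f(x) *)

Lemma lebesgue_measurable_fun_dilate (R : realType) (f : R -> R) (c : R) :
  0 < c -> lebesgue_measurable_fun `]0, +oo[ f ->
  lebesgue_measurable_fun `]0, +oo[ (fun x => f (c * x)).
Proof.
move=> c0 mf mD Y mY.
have := lebesgue_measurable_preimageZ c0 (mf mD _ mY).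
rewrite (_ : _ @^-1` _ = `]0, +oo[ `&` (fun x => f (c * x)) @^-1` Y)//.
by apply/seteqP; split => x /=; rewrite !in_itv/= !andbT pmulr_rgt0.
Qed.

Lemma cvg_ess_ratio (R : realType) (f k : R -> R) (s : R) (D : set R) :
  (forall x, 0 < x -> 0 < f x) -> lebesgue_measurable_fun `]0, +oo[ f ->
  0 < s -> D `<=` `]0, +oo[ -> lebesgue_measurable D -> ~ lebesgue_null D ->
  (forall l, D l ->
    f (s * (ratr q * l)) / f (ratr q * l) @[q --> +oo_rat] --> k l) ->
  cvg (f (s * x) / f x @[x --> @ess_pinfty R]).
Proof.
move=> f0 mf s0 Dpos mD nD fk.
apply: cauchy_cvg; apply: cauchy_exP => e e0.
(* A rational centre and an integer, serving both as bound on [l] and as threshold for [q], make the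
   cover countable. Multiplying out the denominator eases measurability. *)
pose F (i : nat * rat) := [set l | [/\ D l, l <= i.1%:R & forall q : rat,
  i.1%:R < q -> `|f (s * (ratr q * l)) - ratr i.2 * f (ratr q * l)|
                <= e / 2 * f (ratr q * l)]].
have DF : D `<=` \bigcup_i F i.
  move=> l Dl.
  have [c cP] : exists c : rat, `|k l - ratr c| < e / 4.
    have /rat_in_itvoo[c] : k l - e / 4 < k l + e / 4 by lra.
    rewrite in_itv/= => /andP[h1 h2]; exists c.
    by rewrite ltr_norml; apply/andP; split; lra.
  have e4 : 0 < e / 4 by rewrite divr_gt0.
  have l0 : 0 < l by have := Dpos _ Dl; rewrite /= in_itv/= andbT.
  have /cvgrPdist_lt /(_ _ e4) [M [_ HM]] := fk _ Dl.
  have [n [nM nl]] : exists n : nat, M < n%:R /\ l <= n%:R.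
    exists (maxn (Num.truncn M) (Num.truncn l)).+1; split.
      by rewrite -truncn_le_nat leq_maxl.
    by apply: ltW; rewrite -truncn_le_nat leq_maxr.
  exists (n, c) => //; split => //= q nq.
  have q0 : 0 < q by rewrite (le_lt_trans _ nq).
  have fql : 0 < f (ratr q * l) by apply: f0; rewrite mulr_gt0 ?ltr0q.
  rewrite -ler_pdivrMr// -[X in _ / X](gtr0_norm fql) -normf_div mulrBl.
  rewrite mulfK ?gt_eqF//.
  have := HM q (lt_trans nM nq); rewrite distrC => kq.
  (* The ratio is within [e / 4] of [k l], and [k l] within [e / 4] of [c]. *)
  rewrite (le_trans (ler_distD (k l) _ _))//; lra.
have [[n c] nF] := lebesgue_nonnull_piece nD DF.
exists (ratr c); apply: (ess_pinfty_rat_dilates _ _ nF (m := n%:R) (n := n)).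
- by move=> l [/Dpos].
(* For [q > n] the set is cut down to the half-line on which [f] is known to be measurable; other
   [q] impose no condition. *)
- pose G q := if n%:R < q then `]0, +oo[ `&`
    [set l | `|f (s * (ratr q * l)) - ratr c * f (ratr q * l)|
                <= e / 2 * f (ratr q * l)] else setT.
  have -> : F (n, c) = D `&` (`]-oo, n%:R] `&` [set l | forall q, G q l]).
    apply/seteqP; split => l.
      move=> [Dl ln lq]; split => //; split => /=; first by rewrite in_itv.
      move=> q; rewrite /G; case: ifP => // nq; split; first exact: Dpos.
      exact: lq.
    move=> [Dl [ln lq]]; split => //.
    by move=> q nq; have := lq q; rewrite /G nq => -[].
  apply: measurableI => //; apply: measurableI.
    exact: lebesgue_measurable_itv.
  apply: lebesgue_measurable_forall_rat => q; rewrite /G; case: ifPn => nq.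
    have q0 : 0 < ratr q :> R by rewrite ltr0q (le_lt_trans _ nq).
    have mq := lebesgue_measurable_fun_dilate q0 mf.
    have msq : lebesgue_measurable_fun `]0, +oo[ (fun l => f (s * (ratr q * l))).
      rewrite (_ : (fun l => _) = fun l => f (s * ratr q * l)).
        exact: lebesgue_measurable_fun_dilate (mulr_gt0 s0 q0) mf.
      by apply/funext => l; rewrite mulrA.
    apply: measurable_fun_le.
    + exact: lebesgue_measurable_itv.
    + apply: measurableT_comp => //; apply: measurable_funB => //.
      by apply: measurable_funM => //; exact: measurable_cst.
    + by apply: measurable_funM => //; exact: measurable_cst.
  by rewrite /lebesgue_measurable; exact: measurableT.
- by move=> l [].
- move=> l q [Dl _ /= lq] nq; rewrite /ball/=.
  have q0 : 0 < q by rewrite (le_lt_trans _ nq).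
  have l0 : 0 < l by have := Dpos _ Dl; rewrite /= in_itv/= andbT.
  have fql : 0 < f (ratr q * l) by apply: f0; rewrite mulr_gt0 ?ltr0q.
  rewrite distrC (_ : _ - _ = (f (s * (ratr q * l)) -
      ratr c * f (ratr q * l)) / f (ratr q * l)); last first.
    by rewrite mulrBl mulfK ?gt_eqF.
  rewrite normf_div (gtr0_norm fql) ltr_pdivrMr// (le_lt_trans (lq _ nq))//.
  by rewrite ltr_pM2r//; lra.
Qed.

(** If [l] and [s l] both lie in the piece [F n], the ratio at [q l] is a quotient of two numbers
    between [1 / n] and [n]. Non-nullness is returned as well, so that both facts hold for the same
    [s]. *)
Lemma ess_ratio_bounded_near1 (R : realType) (f g : R -> R) (a : rat -> R)
    (B : set R) :
  (forall x, 0 < x -> 0 < f x) -> lebesgue_measurable_fun `]0, +oo[ f ->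
  B `<=` `]0, +oo[ -> lebesgue_measurable B -> ~ lebesgue_null B ->
  (forall l, B l -> 0 < g l) ->
  (forall l, B l -> a q * f (ratr q * l) @[q --> +oo_rat] --> g l) ->
  exists C : R, \forall s \near (1 : R),
    ~ lebesgue_null (B `&` *%R s @^-1` B) /\
    \forall x \near @ess_pinfty R, f (s * x) / f x <= C.
Proof.
move=> f0 mf Bpos mB nB g0 fg.
pose F (n : nat) := [set l | [/\ B l, l <= n%:R & forall q : rat, n%:R < q ->
  1 <= n%:R * (a q * f (ratr q * l)) /\ a q * f (ratr q * l) <= n%:R]].
have BF : B `<=` \bigcup_n F n.
  move=> l Bl; have gl := g0 _ Bl.
  have gl2 : 0 < g l / 2 by rewrite divr_gt0.
  have /cvgrPdist_lt /(_ _ gl2) [M [_ HM]] := fg _ Bl.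
  (* Beyond [M], the value [a q * f (ratr q * l)] lies between [g l / 2] and [3 * g l / 2]; the last
     two terms of the maximum turn this into the bounds in [n]. *)
  pose n := (maxn (maxn (Num.truncn M) (Num.truncn l))
    (maxn (Num.truncn (2 * g l)) (Num.truncn (2 / g l)))).+1.
  have nM : M < n%:R by rewrite -truncn_le_nat !leq_max leqnn.
  have nl : l < n%:R by rewrite -truncn_le_nat !leq_max leqnn orbT.
  have ng : 2 * g l < n%:R by rewrite -truncn_le_nat !leq_max leqnn !orbT.
  have nVg : 2 / g l < n%:R by rewrite -truncn_le_nat !leq_max leqnn !orbT.
  exists n => //; split => //; first exact: ltW.
  move=> q nq; have := HM q (lt_trans nM nq); rewrite ltr_norml => /andP[h1 h2].
  split; last by lra.
  move: nVg; rewrite ltr_pdivrMr// => nVg.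
  have : n%:R * (g l / 2) <= n%:R * (a q * f (ratr q * l)).
    by rewrite ler_wpM2l//; lra.
  lra.
have [n nF] := lebesgue_nonnull_piece nB BF.
have Fpos : F n `<=` `]0, +oo[ by move=> l [/Bpos].
have mF : lebesgue_measurable (F n).
  pose G q := if n%:R < q then `]0, +oo[ `&`
    ([set l | 1 <= n%:R * (a q * f (ratr q * l))] `&`
     [set l | a q * f (ratr q * l) <= n%:R]) else setT.
  have -> : F n = B `&` (`]-oo, n%:R] `&` [set l | forall q, G q l]).
    apply/seteqP; split => l.
      move=> [Bl ln lq]; split => //; split => /=; first by rewrite in_itv.
      move=> q; rewrite /G; case: ifP => // nq; split; first exact: Bpos.
      exact: lq.
    move=> [Bl [ln lq]]; split => //.
    by move=> q nq; have := lq q; rewrite /G nq => -[].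
  apply: measurableI => //; apply: measurableI.
    exact: lebesgue_measurable_itv.
  apply: lebesgue_measurable_forall_rat => q; rewrite /G; case: ifPn => nq.
    have q0 : 0 < ratr q :> R by rewrite ltr0q (le_lt_trans _ nq).
    have maf : lebesgue_measurable_fun `]0, +oo[ (fun l => a q * f (ratr q * l)).
      apply: measurable_funM; first exact: measurable_cst.
      exact: lebesgue_measurable_fun_dilate q0 mf.
    rewrite setIIr; apply: measurableI.
      apply: measurable_fun_le; [exact: lebesgue_measurable_itv|exact: measurable_cst|].
      by apply: measurable_funM => //; exact: measurable_cst.
    by apply: measurable_fun_le; [exact: lebesgue_measurable_itv| |exact: measurable_cst].
  by rewrite /lebesgue_measurable; exact: measurableT.
exists (n%:R * n%:R).
have s0 : \forall s \near (1 : R), 0 < s by exact: lt_nbhsr.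
apply: filterS2 s0 (steinhaus_dilate Fpos mF nF) => s s0 nD.
split.
  by apply: contra_not nD; apply: lebesgue_nullS => l [[Bl _ _] [Bsl _ _]].
apply: (ess_pinfty_rat_dilates _ _ nD (m := n%:R) (n := n)).
- by move=> l [/Fpos].
- by apply: measurableI => //; exact: lebesgue_measurable_preimageZ.
- by move=> l [[]].
- move=> l q [[Bl _ Fl] [Bsl _ Fsl]] nq.
  have l0 : 0 < l by have := Bpos _ Bl; rewrite /= in_itv/= andbT.
  have q0 : 0 < ratr q :> R by rewrite ltr0q (le_lt_trans _ nq).
  have fq0 : 0 < f (ratr q * l) by apply: f0; rewrite mulr_gt0.
  have [] := Fl _ nq; have [] := Fsl _ nq.
  rewrite (mulrCA _ s) => _ hs h1 h2.
  (* The lower bound in [F n] forces the sign: with [a q <= 0] the product could not reach 1. *)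
  have a0 : 0 < a q.
    rewrite -(pmulr_lgt0 _ fq0) ltNge; apply/negP => h.
    have := mulr_ge0_le0 (ler0n R n) h; lra.
  rewrite /= ler_pdivrMr// -(ler_pM2l a0) (le_trans hs)//.
  rewrite mulrCA -mulrA -[leLHS]mulr1 ler_wpM2l//.
Qed.

(** * Bounded multiplicative functions *)

Lemma additive_bounded_linear (R : realType) (phi : R -> R) (C : R) :
  (forall u v, phi (u + v) = phi u + phi v) ->
  (\forall u \near (0 : R), phi u <= C) ->
  forall u, phi u = phi 1 * u.
Proof.
move=> phiD [d /= d0 phiC].
have phi0 : phi 0 = 0 by have := phiD 0 0; rewrite addr0; lra.
have phiN u : phi (- u) = - phi u.
  by have := phiD u (- u); rewrite subrr phi0; lra.
have phiMn u n : phi (u *+ n) = phi u *+ n.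
  by elim: n => [|n IH]; rewrite ?mulr0n ?phi0// !mulrS phiD IH.
have phiMz u (k : int) : phi (u *~ k) = phi u *~ k.
  by case: k => n; rewrite ?NegzE -?pmulrn -?nmulrn ?phiN phiMn.
have phi_rat q : phi (ratr q) = phi 1 * ratr q.
  have dq0 : (denq q)%:~R != 0 :> R by rewrite intr_eq0 denq_neq0.
  have qE : ratr q * (denq q)%:~R = (numq q)%:~R :> R by rewrite /ratr divfK.
  apply: (mulIf dq0); rewrite -mulrA qE mulrzr -phiMz -mulrzr qE.
  by rewrite phiMz mulrzr.
(* phi u - phi 1 * u vanishes at rationals, so by density all its values are
   attained near 0. *)
have bnd u : phi u - phi 1 * u <= C + `|phi 1| * d.
  have /rat_in_itvoo[q] : u - d < u + d by lra.
  rewrite in_itv/= => /andP[h1 h2].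
  have ud : `|u - ratr q| < d by rewrite ltr_norml; apply/andP; split; lra.
  have := phiC (u - ratr q); rewrite /ball/= sub0r normrN => /(_ ud).
  rewrite phiD phiN phi_rat.
  have : `|phi 1 * (u - ratr q)| <= `|phi 1| * d.
    by rewrite normrM ler_wpM2l// ltW.
  rewrite ler_norml => /andP[]; lra.
(* The defect is additive, so a positive value at [u] would exceed the bound at a large multiple of
   [u]. Applied to [- u], this gives the reverse inequality. *)
have le0 u : phi u - phi 1 * u <= 0.
  rewrite leNgt; apply/negP => pos.
  set b := C + _ in bnd; set p := phi u - _ in pos.
  have := bnd (u *+ (Num.truncn (b / p)).+1).
  rewrite phiMn mulrnAr -mulrnBl -/p -mulr_natl -ler_pdivlMr// leNgt.
  by rewrite truncnS_gt.
move=> u; have := le0 u; have := le0 (- u); rewrite phiN; lra.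
Qed.

(** Conjugation by the exponential turns [K] into an additive function bounded above near 0. *)
Lemma multiplicative_bounded_powR (R : realType) (K : R -> R) (C : R) :
  (forall s, 0 < s -> 0 < K s) ->
  (forall s t, 0 < s -> 0 < t -> K (s * t) = K s * K t) ->
  (\forall s \near (1 : R), K s <= C) ->
  exists kappa, forall s, 0 < s -> K s = s `^ kappa.
Proof.
move=> K0 KM KC; pose phi u := ln (K (expR u)).
have phiD u v : phi (u + v) = phi u + phi v.
  by rewrite /phi expRD KM ?expR_gt0// lnM ?posrE ?K0 ?expR_gt0.
have phiC : \forall u \near (0 : R), phi u <= ln C.
  have : \forall u \near (0 : R), K (expR u) <= C.
    by have := @continuous_expR R 0; rewrite /continuous_at expR0 => /(_ _ KC).
  apply: filterS => u uC; rewrite /phi ler_ln ?posrE ?K0 ?expR_gt0//.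
  by rewrite (lt_le_trans _ uC)// K0 ?expR_gt0.
exists (phi 1) => s s0.
rewrite /powR gt_eqF// -(additive_bounded_linear phiD phiC) /phi !lnK ?posrE//.
exact: K0.
Qed.

(** * The limit function *)

(** Every [s > 0] is the n-th power of its n-th root, which is near 1 for large n. *)
Lemma mul_closed_near1_pos (R : realType) (P : R -> Prop) :
  (forall s t, 0 < s -> 0 < t -> P s -> P t -> P (s * t)) ->
  (\forall s \near (1 : R), P s) -> forall s, 0 < s -> P s.
Proof.
move=> PM P1 s s0.
have Pe : \forall u \near (0 : R), P (expR u).
  by have := @continuous_expR R 0; rewrite /continuous_at expR0 => /(_ _ P1).
have [d /= d0 Pd] := Pe.
pose n := (Num.truncn (`|ln s| / d)).+1.
have Pn : P (expR (ln s / n%:R)).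
  apply: Pd; rewrite /ball/= sub0r normrN normf_div [`|n%:R|]ger0_norm//.
  by rewrite ltr_pdivrMr// mulrC -ltr_pdivrMr// truncnS_gt.
have PX m : P (expR (ln s / n%:R *+ m)).
  elim: m => [|m IH]; first by rewrite mulr0n expR0; exact: nbhs_singleton P1.
  by rewrite mulrS expRD; exact: PM (expR_gt0 _) (expR_gt0 _) Pn IH.
have := PX n; rewrite -mulr_natr divfK ?pnatr_eq0//.
by rewrite lnK// posrE.
Qed.

(** Insert [f (t * x)]: the ratio for [s * t] is the ratio for [s] at [t * x] times the ratio for
    [t] at [x]. *)
Lemma cvg_ess_ratioM (R : realType) (f : R -> R) (s t ks kt : R) :
  (forall x, 0 < x -> 0 < f x) -> 0 < t ->
  f (s * x) / f x @[x --> @ess_pinfty R] --> ks ->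
  f (t * x) / f x @[x --> @ess_pinfty R] --> kt ->
  f (s * t * x) / f x @[x --> @ess_pinfty R] --> ks * kt.
Proof.
move=> f0 t0 cs ct.
apply: cvg_trans (cvgM (cvg_comp _ _ (ess_pinftyZ t0) cs) ct).
apply: near_eq_cvg; apply: filterS (ess_pinfty_gt 0) => x x0 /=.
rewrite -[s * t * x]mulrA [LHS]mulrA divfK//.
by rewrite gt_eqF// f0// mulr_gt0.
Qed.

Lemma cvg_ess_ratio1 (R : realType) (f : R -> R) :
  (forall x, 0 < x -> 0 < f x) ->
  f (1 * x) / f x @[x --> @ess_pinfty R] --> (1 : R).
Proof.
move=> f0; apply: cvg_near_cst; apply: filterS (ess_pinfty_gt 0) => x x0.
by rewrite mul1r divff// gt_eqF// f0.
Qed.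

Lemma ess_ratio_ge0 (R : realType) (f : R -> R) (s : R) :
  (forall x, 0 < x -> 0 < f x) -> 0 < s ->
  \forall x \near @ess_pinfty R, 0 <= f (s * x) / f x.
Proof.
move=> f0 s0; apply: filterS (ess_pinfty_gt 0) => x x0.
by rewrite divr_ge0// ltW// f0// mulr_gt0.
Qed.

(** The factor [a q] cancels in the quotient of the two convergent families. *)
Lemma cvg_rat_ratio (R : realType) (f g : R -> R) (a : rat -> R) (s l : R) :
  (forall q, 0 < q -> 0 < a q) -> 0 < g l ->
  a q * f (ratr q * l) @[q --> +oo_rat] --> g l ->
  a q * f (ratr q * (s * l)) @[q --> +oo_rat] --> g (s * l) ->
  f (s * (ratr q * l)) / f (ratr q * l) @[q --> +oo_rat] --> g (s * l) / g l.
Proof.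
move=> a0 gl cl csl.
apply: cvg_trans (cvgM csl (cvgV _ cl)); last by rewrite gt_eqF.
apply: near_eq_cvg; exists 0; split => // q q0 /=.
by rewrite -mulf_div divff ?mul1r 1?mulrCA// gt_eqF// a0.
Qed.

Unset Implicit Arguments.

Theorem mainTheorem5 (R : realType) (f : R -> R)
    (f_gt0 : forall x : R, 0 < x -> 0 < f x)
    (f_meas : lebesgue_measurable_fun `]0, +oo[ f)
    (B : set R) (B_pos : B `<=` `]0, +oo[)
    (B_meas : lebesgue_measurable B) (B_nonnull : ~ lebesgue_null B)
    (a : rat -> R) (a_gt0 : forall q : rat, 0 < q -> 0 < a q)
    (g : R -> R) (g_gt0 : forall l : R, B l -> 0 < g l)
    (afg : forall l : R, B l ->
       a q * f (ratr q * l) @[q --> +oo_rat] --> g l) :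
  weakly_almost_regularly_varying f /\
  exists K : R -> R,
    [/\ forall s : R, 0 < s -> is_ess_lim (fun l => f (s * l) / f l) (K s),
        forall s t : R, 0 < s -> 0 < t -> K (s * t) = K s * K t,
        bounded_near K (nbhs (1 : R))
      & exists kappa : R, forall s : R, 0 < s -> K s = s `^ kappa].
Proof.
have [C near1] :=
  ess_ratio_bounded_near1 f_gt0 f_meas B_pos B_meas B_nonnull g_gt0 afg.
have pos1 : \forall s \near (1 : R), 0 < s by exact: lt_nbhsr.
pose F s : set_system R := f (s * x) / f x @[x --> ess_pinfty (R := R)].
(* Near 1 the limit exists because [B] meets its dilate in a non-null set; products then reach every
   [s > 0]. *)
have cvgF : forall s : R, 0 < s -> cvg (F s).
  apply: (@mul_closed_near1_pos _ (fun s => cvg (F s))) => [s t s0 t0 cs ct|].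
    apply/cvg_ex; exists (lim (F s) * lim (F t)).
    exact: cvg_ess_ratioM f_gt0 t0 cs ct.
  apply: filterS2 pos1 near1 => s s0 [nD _].
  apply: (cvg_ess_ratio (k := fun l => g (s * l) / g l) f_gt0 f_meas s0 _ _ nD).
  - by move=> l [/B_pos].
  - by apply: measurableI => //; exact: lebesgue_measurable_preimageZ.
  - move=> l [Bl Bsl]; apply: cvg_rat_ratio a_gt0 _ _ _.
    + exact: g_gt0.
    + exact: afg.
    + exact: afg.
(* For [s <= 0] this may be a default value of [lim]; all claims about [K] concern [s > 0]. *)
pose K s := lim (F s).
have KM s t : 0 < s -> 0 < t -> K (s * t) = K s * K t.
  move=> s0 t0; apply: cvg_lim => //.
  by apply: cvg_ess_ratioM => //; exact: cvgF.
have K1 : K 1 = 1 by apply: cvg_lim => //; exact: cvg_ess_ratio1.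
(* The limit is nonnegative, and it cannot vanish since [K s * K s^-1 = K 1 = 1]. *)
have K_gt0 s : 0 < s -> 0 < K s.
  move=> s0; rewrite lt_neqAle; apply/andP; split; last first.
    by apply: limr_ge; [exact: cvgF|exact: ess_ratio_ge0].
  apply/eqP => Ks0; have := KM s s^-1 s0; rewrite invr_gt0 => /(_ s0).
  by rewrite divff ?gt_eqF// K1 -Ks0 mul0r => /eqP; rewrite oner_eq0.
have KC : \forall s \near (1 : R), K s <= C.
  apply: filterS2 pos1 near1 => s s0 [_ h].
  by apply: limr_le => //; exact: cvgF.
have essK s : 0 < s -> is_ess_lim (fun l => f (s * l) / f l) (K s).
  by move=> s0; apply/is_ess_limP; exact: cvgF.
split; first by split => // t t0; exists (K t); exact: essK.
exists K; split => //; last exact: multiplicative_bounded_powR K_gt0 KM KC.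
(* Positivity of [K] turns the upper bound into a bound on its absolute value. *)
exists C; split; first exact: num_real.
move=> M CM; apply: filterS2 pos1 KC => s s0 sC /=.
by rewrite gtr0_norm ?K_gt0// (le_trans sC)// ltW.
Qed.
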